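(* Let $c\in\{0,N\}$ and let $[x_k]=(x_0,\ldots,x_N)$ be a zero-mean nonsingular Gaussian (ZMNG) $CM_c$ sequence of $\mathbb{R}^d$-valued random vectors. Then the representation $$x_k=y_k+\Gamma_kx_c,\quad k\in[0,N]\setminus\{c\},$$ in which $(y_k)_{k\in[0,N]\setminus\{c\}}$ is a ZMNG Markov sequence uncorrelated with $x_c$ and $\Gamma_k$ are $d\times d$ matrices, is unique: if also $x_k=\tilde y_k+\tilde\Gamma_kx_c$, $k\in[0,N]\setminus\{c\}$, with $(\tilde y_k)_{k\in[0,N]\setminus\{c\}}$ a ZMNG Markov sequence uncorrelated with $x_c$ and $\tilde\Gamma_k$ matrices, then $\tilde\Gamma_k=\Gamma_k$ and $\tilde y_k=y_k$ (almost surely) for all $k\in[0,N]\setminus\{c\}$.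
   Context: $N$ is a positive integer and $[i,j]=\{i,i+1,\ldots,j\}$; $[x_k]$ denotes $(x_k)_{k\in[0,N]}$. A sequence is zero-mean nonsingular Gaussian (ZMNG) if the stacked vector of all its terms is jointly Gaussian with zero mean and nonsingular covariance matrix. For $c=N$ the index set $[0,N]\setminus\{c\}$ is $[0,N-1]$, and for $c=0$ it is $[1,N]$. A sequence indexed by an interval of integers is Markov if, conditioned on the state at any time $k$, the segment before $k$ is independent of the segment after $k$ (sequences of length less than 3 are Markov). A sequence $[x_k]$ is $CM_c$ if, for all $j<k$ in $[0,N]$, the conditional distribution of $x_k$ given $(x_0,\ldots,x_j,x_c)$ equals the conditional distribution of $x_k$ given $(x_j,x_c)$ (i.e. conditioned on $x_c$ the sequence is Markov over $[0,N]\setminus\{c\}$). *)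

(* Defs.v *)
From mathcomp Require Import all_boot all_order all_algebra.
From mathcomp Require Import all_classical all_reals all_analysis.

Set Implicit Arguments.
Unset Strict Implicit.
Unset Printing Implicit Defensive.

Import Order.TTheory GRing.Theory Num.Theory.

Local Open Scope classical_set_scope.
Local Open Scope ring_scope.

(* A sequence of n random vectors in R^d is x : 'I_n -> T -> 'cV[R]_d; only the
   order of its indices matters below, so a sequence indexed by an interval of
   n integers is reindexed increasingly by 'I_n. *)

Definition random_vector {disp : measure_display} {T : measurableType disp}
    {R : realType} (d : nat) (X : T -> 'cV[R]_d) : Prop :=
  forall i : 'I_d, measurable_fun [set: T] (fun t => X t i 0).

Definition cov_mx {disp : measure_display} {T : measurableType disp}
    {R : realType} (P : probability T R) (m n : nat)
    (X : T -> 'cV[R]_m) (Y : T -> 'cV[R]_n) : 'M[R]_(m, n) :=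
  \matrix_(i < m, j < n)
    fine (covariance P (fun t => X t i 0) (fun t => Y t j 0)).

Definition uncorrelated {disp : measure_display} {T : measurableType disp}
    {R : realType} (P : probability T R) (m n : nat)
    (X : T -> 'cV[R]_m) (Y : T -> 'cV[R]_n) : Prop :=
  cov_mx P X Y = 0.

(* The library's normal_prob m 0 is a uniform law, hence the separate
   degenerate case, a point mass at m. *)
Definition gaussian {disp : measure_display} {T : measurableType disp}
    {R : realType} (P : probability T R) (X : T -> R) : Prop :=
  exists m s : R, forall B : set R, measurable B ->
    P (X @^-1` B) = if s == 0 then \d_m B else normal_prob m s B.

Definition jointly_gaussian {disp : measure_display} {T : measurableType disp}
    {R : realType} (P : probability T R) (m : nat) (X : T -> 'cV[R]_m) : Prop :=
  forall a : 'rV[R]_m, gaussian P (fun t => (a *m X t) 0 0).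

Definition stack {T : Type} {R : realType} (n d : nat)
    (x : 'I_n -> T -> 'cV[R]_d) (t : T) : 'cV[R]_(\sum_(k < n) d) :=
  \mxcol_(k < n) x k t.

Definition ZMNG {disp : measure_display} {T : measurableType disp}
    {R : realType} (P : probability T R) (n d : nat)
    (x : 'I_n -> T -> 'cV[R]_d) : Prop :=
  [/\ forall k, random_vector (x k),
      jointly_gaussian P (stack x),
      forall i, 'E_P[fun t => stack x t i 0%R]%E = 0%E
    & cov_mx P (stack x) (stack x) \in unitmx].

(* The sigma-algebra on T generated by the x k with k in D. *)
Definition sigma_seq {disp : measure_display} {T : measurableType disp}
    {R : realType} (n d : nat) (x : 'I_n -> T -> 'cV[R]_d) (D : set 'I_n) :
    set_system T :=
  <<s \bigcup_(k in D) \bigcup_(i in [set: 'I_d])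
        preimage_set_system [set: T] (fun t => x k t i 0) measurable >>.

(* Z is a version of the conditional probability P(A | G). *)
Definition cond_prob {disp : measure_display} {T : measurableType disp}
    {R : realType} (P : probability T R) (G : set_system T) (A : set T)
    (Z : T -> R) : Prop :=
  [/\ P.-integrable [set: T] (EFin \o Z),
      preimage_set_system [set: T] Z measurable `<=` G
    & forall B, G B -> (\int[P]_(t in B) (Z t)%:E = P (A `&` B))%E].

(* Here and in CM, versions exist and are almost surely unique
   (Radon-Nikodym), so "some version" and "every version" agree. *)
Definition cond_indep {disp : measure_display} {T : measurableType disp}
    {R : realType} (P : probability T R) (F H G : set_system T) : Prop :=
  forall A B, F A -> H B ->
    exists ZA ZB : T -> R,
      [/\ cond_prob P G A ZA, cond_prob P G B ZB
        & cond_prob P G (A `&` B) (ZA \* ZB)].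

(* If n < 3, one of the two segments is empty for every k, so that the
   condition is automatic. *)
Definition Markov {disp : measure_display} {T : measurableType disp}
    {R : realType} (P : probability T R) (n d : nat)
    (x : 'I_n -> T -> 'cV[R]_d) : Prop :=
  forall k : 'I_n,
    cond_indep P (sigma_seq x [set i : 'I_n | (i < k)%N])
                 (sigma_seq x [set i : 'I_n | (k < i)%N])
                 (sigma_seq x [set k]).

(* The conditional law of x k given a sigma-algebra G is given by the
   P(A | G) for A = (x k) @^-1` B with B Borel, that is, A in the
   sigma-algebra generated by x k. *)
Definition CM {disp : measure_display} {T : measurableType disp}
    {R : realType} (P : probability T R) (N d : nat) (c : 'I_N.+1)
    (x : 'I_N.+1 -> T -> 'cV[R]_d) : Prop :=
  forall j k : 'I_N.+1, (j < k)%N ->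
  forall A, sigma_seq x [set k] A ->
    exists Z : T -> R,
      cond_prob P (sigma_seq x ([set i : 'I_N.+1 | (i <= j)%N] `|` [set c]))
        A Z /\
      cond_prob P (sigma_seq x [set j; c]) A Z.

(* lift c : 'I_N -> 'I_N.+1 enumerates the indices other than c increasingly. *)
Definition CM_representation {disp : measure_display}
    {T : measurableType disp} {R : realType} (P : probability T R)
    (N d : nat) (c : 'I_N.+1) (x : 'I_N.+1 -> T -> 'cV[R]_d)
    (y : 'I_N -> T -> 'cV[R]_d) (Gamma : 'I_N -> 'M[R]_d) : Prop :=
  [/\ ZMNG P y, Markov P y,
      forall k, uncorrelated P (y k) (x c)
    & forall k : 'I_N,
        {ae P, forall t, x (lift c k) t = y k t + Gamma k *m x c t}].

(* Main.v *)
(* Subtracting the two representations gives (Gamma'_k - Gamma_k) x_c = y_k - y'_k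
   almost surely, and the right-hand side is uncorrelated with x_c. So each
   component of (Gamma'_k - Gamma_k) x_c is a linear combination of the
   components of x_c and uncorrelated with all of them: its variance is 0. The
   covariance matrix of x being nonsingular, the combination is trivial, whence
   Gamma'_k = Gamma_k and then y'_k = y_k almost surely. Covariances are bilinear
   only on square-integrable functions, hence the second moment of the normal
   law. *)
Require Import Defs.
From mathcomp Require Import all_boot all_order all_algebra.
From mathcomp Require Import all_classical all_reals all_analysis.
From mathcomp Require Import measurable_realfun.
From mathcomp Require Import ring lra.

Set Implicit Arguments.
Unset Strict Implicit.
Unset Printing Implicit Defensive.

Import Order.TTheory GRing.Theory Num.Theory.

Local Open Scope classical_set_scope.
Local Open Scope ring_scope.

(** * Integrals against the normal law and its second moment *)

Section normal_second_moment.
Context {R : realType}.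
Implicit Types m s x : R.

(** The Radon-Nikodym derivative of the normal law and [normal_pdf] have the same integral over
    every measurable set, so they agree almost everywhere. *)
Lemma ge0_integral_normal_prob m s (f : R -> \bar R) :
  (forall x, 0 <= f x)%E -> measurable_fun [set: R] f ->
  (\int[normal_prob m s]_x f x =
   \int[lebesgue_measure]_x (f x * (normal_pdf m s x)%:E))%E.
Proof.
move=> f0 mf.
have dom := @normal_prob_dominates R m s.
rewrite -(Radon_Nikodym_SigmaFinite.change_of_variables dom f0 measurableT mf).
apply: ae_eq_integral => //.
- apply: emeasurable_funM => //; apply: measurable_int.
  exact: Radon_Nikodym_SigmaFinite.f_integrable.
- apply: emeasurable_funM => //; apply/measurable_EFinP.
  exact: measurable_normal_pdf.
- apply: ae_eqe_mul2l; apply: integral_ae_eq => //.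
  + exact: Radon_Nikodym_SigmaFinite.f_integrable.
  + by apply/measurable_EFinP; exact: measurable_normal_pdf.
  + by move=> E _ mE; rewrite -Radon_Nikodym_SigmaFinite.f_integral.
Qed.

(* With [t = (x - m) ^ 2 / (8 s ^ 2)], the normal density is at most
   [expR (- t) ^ 2]; one factor absorbs [x ^ 2 <= 2 m ^ 2 + 16 s ^ 2 t]. *)
Lemma sqr_normal_fun_le m s x : s != 0 ->
  x ^+ 2 * normal_fun m s x <=
  (2 * m ^+ 2 + 16 * s ^+ 2) * normal_fun m (2 * s) x.
Proof.
move=> s0.
set t := (x - m) ^+ 2 / ((2 * s) ^+ 2 *+ 2).
have t0 : 0 <= t by rewrite divr_ge0 ?mulrn_wge0 ?sqr_ge0.
have tE : (x - m) ^+ 2 = 8 * s ^+ 2 * t by rewrite /t; field.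
have -> : normal_fun m (2 * s) x = expR (- t) by rewrite /normal_fun mulNr.
have -> : normal_fun m s x = expR (- t) * expR (- (3 * t)).
  by rewrite -expRD /normal_fun tE; congr expR; field.
have tx : x ^+ 2 <= (2 * m ^+ 2 + 16 * s ^+ 2) * (1 + t).
  apply: (@le_trans _ _ (2 * m ^+ 2 + 2 * (x - m) ^+ 2)).
    rewrite -subr_ge0.
    have -> : 2 * m ^+ 2 + 2 * (x - m) ^+ 2 - x ^+ 2 = (x - 2 * m) ^+ 2 by ring.
    exact: sqr_ge0.
  have := mulr_ge0 (sqr_ge0 m) t0; have := sqr_ge0 s.
  by rewrite tE; lra.
rewrite mulrCA mulrC ler_wpM2r ?expR_ge0//.
rewrite expRN ler_pdivrMr ?expR_gt0//.
apply: (le_trans tx); apply: ler_wpM2l.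
  by rewrite addr_ge0// mulr_ge0// sqr_ge0.
apply: (le_trans (expR_ge1Dx _)).
by rewrite ler_expR; lra.
Qed.

Lemma normal_prob_second_moment m s : s != 0 ->
  (\int[normal_prob m s]_x (x ^+ 2)%:E < +oo)%E.
Proof.
move=> s0; have s20 : 2 * s != 0 by rewrite mulf_neq0.
rewrite ge0_integral_normal_prob; last 2 first.
- by move=> x; rewrite lee_fin sqr_ge0.
- by apply/measurable_EFinP; exact: measurable_funX.
(* [normal_fun] lacks the normalizing factor; the ratio of peaks turns the bound of
   [sqr_normal_fun_le] into one between densities, and the dominating density has integral 1. *)
set K := (2 * m ^+ 2 + 16 * s ^+ 2) * normal_peak s / normal_peak (2 * s).
have K0 : 0 <= K.
  by rewrite divr_ge0 ?normal_peak_ge0// mulr_ge0 ?normal_peak_ge0//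
    addr_ge0// mulr_ge0// sqr_ge0.
apply: (@le_lt_trans _ _
  (\int[lebesgue_measure]_x (K%:E * (normal_pdf m (2 * s) x)%:E))%E); last first.
  rewrite integralZl//; last exact: integrable_normal_pdf.
  by rewrite integral_normal_pdf mule1 ltry.
apply: ge0_le_integral => //.
- by move=> x _; rewrite mule_ge0 ?lee_fin ?sqr_ge0 ?normal_pdf_ge0.
- apply/measurable_EFinP; apply: measurable_funM.
    exact: measurable_funX.
  exact: measurable_normal_pdf.
- apply/measurable_EFinP; apply: measurable_funM => //.
  exact: measurable_normal_pdf.
- move=> x _; rewrite -!EFinM lee_fin /normal_pdf (negbTE s0) (negbTE s20).
  rewrite /K [leRHS]mulrA divfK ?gt_eqF ?normal_peak_gt0//.
  rewrite mulrCA (mulrC _ (normal_peak s)) -[leRHS]mulrA.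
  by rewrite ler_wpM2l ?normal_peak_ge0// sqr_normal_fun_le.
Qed.

End normal_second_moment.

(** * Covariance calculus on square-integrable variables *)

Section square_integrable.
Context {disp : measure_display} {T : measurableType disp} {R : realType}.
Variable P : probability T R.
Implicit Types X Y Z : T -> R.

Lemma Lfun2_second_moment X : measurable_fun [set: T] X ->
  (\int[P]_t (X t ^+ 2)%:E < +oo)%E -> X \in Lfun P 2%:E.
Proof.
move=> mX X2; rewrite inE; apply/andP; split; rewrite inE//=.
rewrite /finite_norm unlock /Lnorm; apply: poweR_lty.
under eq_integral do rewrite /= powR_mulrn// real_normK ?num_real//.
exact: X2.
Qed.

(** The second moment depends only on the law of [X], which is a point mass or a normal law. *)
Lemma gaussian_Lfun2 X : measurable_fun [set: T] X -> gaussian P X ->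
  X \in Lfun P 2%:E.
Proof.
move=> mX [m [s Xms]]; apply: Lfun2_second_moment => //.
(* Retyping [X] puts its law on the same measurable type as [normal_prob m s]. *)
pose Y : T -> measurableTypeR R := X; have mY : measurable_fun setT Y := mX.
have msqr : measurable_fun setT (fun x : measurableTypeR R => (x ^+ 2)%:E).
  by apply/measurable_EFinP; exact: measurable_funX.
have -> : (\int[P]_t (X t ^+ 2)%:E = \int[pushforward P Y]_x (x ^+ 2)%:E)%E.
  rewrite ge0_integral_pushforward//.
  by move=> x _; rewrite lee_fin sqr_ge0.
have [s0|s0] := eqVneq s 0.
  have -> : (\int[pushforward P Y]_x (x ^+ 2)%:E =
             \int[\d_(m : measurableTypeR R)]_x (x ^+ 2)%:E)%E.
    by apply: eq_measure_integral => A mA _; rewrite [LHS]Xms// s0 eqxx.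
  by rewrite integral_dirac// diracT mul1e ltry.
have -> : (\int[pushforward P Y]_x (x ^+ 2)%:E =
           \int[normal_prob m s]_x (x ^+ 2)%:E)%E.
  by apply: eq_measure_integral => A mA _; rewrite [LHS]Xms// (negbTE s0).
exact: normal_prob_second_moment.
Qed.

Lemma covariance_fin_num2 X Y : X \in Lfun P 2%:E -> Y \in Lfun P 2%:E ->
  covariance P X Y \is a fin_num.
Proof.
have fP := fin_num_measure P _ measurableT.
by move=> X2 Y2; rewrite covariance_fin_num ?Lfun2_mul_Lfun1 ?Lfun_subset12.
Qed.

Lemma Lfun2_lincomb (I : Type) (r : seq I) (a : I -> R) (X : I -> T -> R) :
  (forall i, X i \in Lfun P 2%:E) ->
  (fun t => \sum_(i <- r) a i * X i t) \in Lfun P 2%:E.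
Proof.
move=> X2.
have -> : (fun t => \sum_(i <- r) a i * X i t) =
    \sum_(i <- r) (a i \o* X i).
  apply/funext => t; rewrite fct_sumE; apply: eq_bigr => i _.
  by rewrite /= mulrC.
elim/big_rec: _ => [|i f _ f2]; first exact: Lfun_cst.
apply: (Lfun_addr_closed P (lee1n 2)).2 => //.
exact: Lfun_scale (ler1n _ 2) _.
Qed.

Lemma covariance_lincombl (I : Type) (r : seq I) (a : I -> R)
    (X : I -> T -> R) Y :
  (forall i, X i \in Lfun P 2%:E) -> Y \in Lfun P 2%:E ->
  covariance P (fun t => \sum_(i <- r) a i * X i t) Y =
  (\sum_(i <- r) (a i)%:E * covariance P (X i) Y)%E.
Proof.
move=> X2 Y2; have fP := fin_num_measure P _ measurableT.
elim: r => [|i r IH].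
  rewrite big_nil -(covariance_cst_l P 0 Y); congr covariance.
  by apply/funext => t; rewrite big_nil.
rewrite big_cons -IH -covarianceZl ?Lfun2_mul_Lfun1 ?Lfun_subset12//.
rewrite -covarianceDl ?Lfun2_lincomb// ?Lfun_scale ?ler1n//.
congr covariance; apply/funext => t.
by rewrite big_cons /= (mulrC (a i)).
Qed.

(** Cauchy-Schwarz bounds the covariances of [X] with [Y] and with [- Y] above by 0. *)
Lemma covariance_variance0 X Y : X \in Lfun P 2%:E -> Y \in Lfun P 2%:E ->
  variance P X = 0%E -> covariance P X Y = 0%E.
Proof.
move=> X2 Y2 VX.
have le0 Z : Z \in Lfun P 2%:E -> (covariance P X Z <= 0)%E.
  by move=> Z2; rewrite (le_trans (covariance_le X2 Z2))// VX sqrte0 mul0e.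
have fP := fin_num_measure P _ measurableT.
apply/eqP; rewrite eq_le le0//= -oppe_le0.
rewrite -covarianceNr ?Lfun2_mul_Lfun1 ?Lfun_subset12//.
by apply: le0; rewrite rpredN.
Qed.

Lemma ae_eq_expectation X Y :
  measurable_fun [set: T] X -> measurable_fun [set: T] Y ->
  {ae P, forall t, X t = Y t} -> ('E_P[X] = 'E_P[Y])%E.
Proof.
move=> mX mY XY; rewrite unlock; apply: ae_eq_integral => //.
- exact/measurable_EFinP.
- exact/measurable_EFinP.
- by apply: filterS XY => t /= -> _.
Qed.

(** Needed because the representations hold only almost surely. *)
Lemma ae_eq_covariancel X Y Z :
  measurable_fun [set: T] X -> measurable_fun [set: T] Y ->
  measurable_fun [set: T] Z ->
  {ae P, forall t, X t = Y t} -> covariance P X Z = covariance P Y Z.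
Proof.
move=> mX mY mZ XY; rewrite unlock (ae_eq_expectation mX mY XY).
apply: ae_eq_expectation.
- by apply: measurable_funM; apply: measurable_funB.
- by apply: measurable_funM; apply: measurable_funB.
- by apply: filterS XY => t /=; rewrite !fctE /= => ->.
Qed.

End square_integrable.

(** * Linear forms in Gaussian vectors and nonsingularity *)

Section random_vectors.
Context {disp : measure_display} {T : measurableType disp} {R : realType}.
Variable P : probability T R.

Lemma mulmx_lincomb m (v : 'rV[R]_m) (X : T -> 'cV[R]_m) :
  (fun t => (v *m X t) 0 0) = (fun t => \sum_i v 0 i * X t i 0).
Proof. by apply/funext => t; rewrite mxE. Qed.

Lemma uncorrelatedP m n (X : T -> 'cV[R]_m) (Y : T -> 'cV[R]_n) :
  (forall i, (fun t => X t i 0) \in Lfun P 2%:E) ->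
  (forall j, (fun t => Y t j 0) \in Lfun P 2%:E) ->
  uncorrelated P X Y ->
  forall i j, covariance P (fun t => X t i 0) (fun t => Y t j 0) = 0%E.
Proof.
move=> X2 Y2 /matrixP XY i j; have := XY i j; rewrite !mxE => XYij.
by rewrite -[LHS]fineK ?covariance_fin_num2// XYij.
Qed.

(** Entry [j] of [v *m cov_mx P X X] is the covariance of [v *m X] with the component [j] of [X]. It
    vanishes with the variance of [v *m X], and the matrix is invertible. *)
Lemma variance0_lincomb m (X : T -> 'cV[R]_m) (v : 'rV[R]_m) :
  (forall i, (fun t => X t i 0) \in Lfun P 2%:E) ->
  cov_mx P X X \in unitmx ->
  variance P (fun t => (v *m X t) 0 0) = 0%E -> v = 0.
Proof.
move=> X2 XX Vv; apply: (can_inj (mulmxK XX)); rewrite mul0mx.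
apply/matrixP => i j; rewrite ord1 !mxE.
have vX2 : (fun t => (v *m X t) 0 0) \in Lfun P 2%:E.
  by rewrite mulmx_lincomb Lfun2_lincomb.
have := covariance_variance0 vX2 (X2 j) Vv.
rewrite mulmx_lincomb covariance_lincombl// => vXj.
apply: EFin_inj; rewrite -[RHS]vXj -sumEFin; apply: eq_bigr => k _.
by rewrite EFinM mxE fineK ?covariance_fin_num2.
Qed.

(** A coordinate is the linear form given by a unit row vector, hence Gaussian by joint
    Gaussianity. *)
Lemma ZMNG_stack_Lfun2 n d (x : 'I_n -> T -> 'cV[R]_d) : ZMNG P x ->
  forall l, (fun t => stack x t l 0) \in Lfun P 2%:E.
Proof.
move=> [mx gx _ _] l; apply: gaussian_Lfun2.
  rewrite /stack; under eq_fun do rewrite mxE.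
  exact: mx.
have := gx (delta_mx 0 l); congr gaussian.
by apply/funext => t; rewrite -rowE mxE.
Qed.

Lemma ZMNG_Lfun2 n d (x : 'I_n -> T -> 'cV[R]_d) : ZMNG P x ->
  forall k i, (fun t => x k t i 0) \in Lfun P 2%:E.
Proof.
move=> zx k i.
(* [tagnat.Rank] gives the position in the stack of entry [i] of block [k]. *)
have -> : (fun t => x k t i 0) =
    (fun t => stack x t (@tagnat.Rank n (fun=> d) k i) 0).
  by apply/funext => t; rewrite -[x k t](mxcolK (x ^~ t) k) mxE.
exact: ZMNG_stack_Lfun2.
Qed.

(** Padding [a] with zero blocks makes it a linear form in the whole stack, whose covariance matrix
    is the one assumed invertible. *)
Lemma ZMNG_variance0 n d (x : 'I_n -> T -> 'cV[R]_d) (k : 'I_n)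
    (a : 'rV[R]_d) : ZMNG P x ->
  variance P (fun t => (a *m x k t) 0 0) = 0%E -> a = 0.
Proof.
move=> zx Va; pose A (j : 'I_n) := if j == k then a else 0.
have Ax t : \mxrow_j A j *m stack x t = a *m x k t.
  rewrite mul_mxrow_mxcol (bigD1 k)//= /A eqxx big1 ?addr0// => j /negbTE ->.
  by rewrite mul0mx.
have [_ _ _ xx] := zx.
have A0 : \mxrow_j A j = 0.
  apply: (variance0_lincomb (ZMNG_stack_Lfun2 zx) xx).
  by under eq_fun do rewrite Ax.
have -> : a = A k by rewrite /A eqxx.
by rewrite -(mxrowK A k) A0 submxrow0.
Qed.

End random_vectors.

(** * Comparison of two representations *)

Theorem corollary4p3 (disp : measure_display) (T : measurableType disp)
    (R : realType) (P : probability T R) (N d : nat) (hN : (0 < N)%N)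
    (c : 'I_N.+1) (hc : c = ord0 \/ c = ord_max)
    (x : 'I_N.+1 -> T -> 'cV[R]_d) (hx : ZMNG P x) (hCM : CM P c x)
    (y y' : 'I_N -> T -> 'cV[R]_d) (Gamma Gamma' : 'I_N -> 'M[R]_d)
    (hy : CM_representation P c x y Gamma)
    (hy' : CM_representation P c x y' Gamma') :
  forall k : 'I_N,
    Gamma' k = Gamma k /\ {ae P, forall t, y' k t = y k t}.
Proof.
move=> k.
have [zy _ /(_ k) uy /(_ k) xy] := hy.
have [zy' _ /(_ k) uy' /(_ k) xy'] := hy'.
have x2 := ZMNG_Lfun2 hx c; have y2 := ZMNG_Lfun2 zy k.
have y'2 := ZMNG_Lfun2 zy' k.
have L2m X : X \in Lfun P 2%:E -> measurable_fun [set: T] X.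
  by move=> /sub_Lfun_mfun; rewrite inE.
have D0 : Gamma' k - Gamma k = 0.
  (* Row by row, it suffices that the scalar [g], component [i] of the difference matrix applied to
     [x c], has variance 0. *)
  apply/row_matrixP => i; rewrite row0; apply: (ZMNG_variance0 (k := c) hx).
  set a := row i _; set g := (fun t => _).
  have gE : g = (fun t => \sum_j a 0 j * x c t j 0) by apply: mulmx_lincomb.
  have g2 : g \in Lfun P 2%:E by rewrite gE Lfun2_lincomb.
  have gy : {ae P, forall t,
      g t = ((fun t => y k t i 0) \- (fun t => y' k t i 0)) t}.
    apply: filterS2 xy xy' => t xt xt' /=.
    rewrite /g /a -row_mul mulmxBl.
    have -> : Gamma' k *m x c t - Gamma k *m x c t = y k t - y' k t.
      apply/eqP; rewrite subr_eq addrAC -xt xt' addrAC subrr add0r //.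
    by rewrite !mxE.
  (* Here [g] is replaced by the difference of the components of [y k] and [y' k], both uncorrelated
     with [x c]. *)
  have gx j : covariance P (fun t => x c t j 0) g = 0%E.
    rewrite covarianceC.
    rewrite (ae_eq_covariancel (L2m _ g2) _ (L2m _ (x2 j)) gy); last first.
      by apply: measurable_funB; apply: L2m.
    by rewrite covarianceBl// !(uncorrelatedP _ _ _) // sube0.
  (* Only the first argument of the covariance of [g] with itself is expanded, so that each term is
     a multiple of some [gx j]. *)
  rewrite /variance {1}gE covariance_lincombl//.
  by rewrite big1// => j _; rewrite gx mule0.
have eG : Gamma' k = Gamma k by apply/eqP; rewrite -subr_eq0 D0.
(* With equal matrices, the common term [Gamma k *m x c t] cancels. *)
split=> //; apply: filterS2 xy xy' => t -> /eqP.
by rewrite eG (inj_eq (addIr _)) => /eqP.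
Qed.
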